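(* Let $F$ be an algebraically closed field of characteristic $0$, let $G$ be a finitely generated additive abelian group and $\beta:G\times G\to F^\times$ an alternating bicharacter. (1) If $(G,\beta,R)$ is a skew root system of Jordan type, then the $G$-graded Jordan algebra $J(R)$ is graded-simple. (2) If $(G,\beta,R)$ is a reduced skew root system of Jordan type, and $G$ is an elementary abelian $2$-group, then $J(R)$ is simple.
   Context: An alternating bicharacter is a $\mathbb{Z}$-bilinear map $\beta:G\times G\to F^\times$ with $\beta(g,g)=1$ for all $g\in G$; $\mathrm{Rad}(\beta)=\{g\in G:\beta(g,h)=1\text{ for all }h\in G\}$. Skew root system of Jordan type $(G,\beta,R)$: a nonempty subset $R\subseteq G$ such that (SRSJ0) $R$ generates $G$; (SRSJ1) $a\in R$ implies $-a\in R$; (SRSJ2) if $a,b\in R$ and $\beta(a,b)\neq -1$, then $a+b\in R$. It is reduced if $\mathrm{Rad}(\beta)=0$. The algebra $J(R)$: choose a 2-cocycle $\xi\in Z^2(G,F^\times)$ (trivial action) with $\xi(a,b)\xi(b,a)^{-1}=\beta(a,b)$ for all $a,b\in G$ (such $\xi$ exists, and different choices give isomorphic graded algebras). The twisted group algebra $F^\xi G$ is the associative algebra with basis $\{u_g:g\in G\}$ and product $u_au_b=\xi(a,b)u_{a+b}$. Then $J(R)=\bigoplus_{a\in R}Fu_a\subseteq F^\xi G$ with Jordan product $x\circ y=\frac12(xy+yx)$, graded by $G$ with $J(R)_a=Fu_a$ for $a\in R$. It may be infinite dimensional. Graded-simple means having no graded ideals other than $0$ and the whole algebra (which has nonzero product).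 *)

(* Defs.v *)
From HB Require Import structures.
From mathcomp Require Import all_boot all_order all_algebra.
From mathcomp Require Import finmap boolp classical_sets.
From mathcomp Require Import monalg.

Set Implicit Arguments.
Unset Strict Implicit.
Unset Printing Implicit Defensive.

Import GRing.Theory.
Local Open Scope classical_set_scope.
Local Open Scope ring_scope.

(** ** Abelian groups *)

Definition subgroup (G : zmodType) (H : set G) : Prop :=
  [/\ H 0, forall a b, H a -> H b -> H (a + b) & forall a, H a -> H (- a)].

Definition generates (G : zmodType) (S : set G) : Prop :=
  forall H : set G, subgroup H -> S `<=` H -> H = setT.

Definition finitely_generated (G : zmodType) : Prop :=
  exists s : seq G, generates [set a | a \in s].

Definition elementary_abelian_2group (G : zmodType) : Prop :=
  forall a : G, a + a = 0.

(** ** Skew root systems of Jordan type *)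

(* Maps G x G -> F^* are F-valued maps that vanish nowhere. *)
Record alternating_bicharacter (F : fieldType) (G : zmodType)
    (beta : G -> G -> F) : Prop := AlternatingBicharacter {
  bichar_neq0 : forall a b, beta a b != 0;
  bicharDl : forall a b c, beta (a + b) c = beta a c * beta b c;
  bicharDr : forall a b c, beta a (b + c) = beta a b * beta a c;
  bichar_alt : forall a, beta a a = 1
}.

Definition Rad (F : fieldType) (G : zmodType) (beta : G -> G -> F) : set G :=
  [set g | forall h, beta g h = 1].

Record skew_root_system (F : fieldType) (G : zmodType) (beta : G -> G -> F)
    (R : set G) : Prop := SkewRootSystem {
  srsj_nonempty : R !=set0;
  srsj0 : generates R;
  srsj1 : forall a, R a -> R (- a);
  srsj2 : forall a b, R a -> R b -> beta a b != -1 -> R (a + b)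
}.

Definition reduced (F : fieldType) (G : zmodType) (beta : G -> G -> F) : Prop :=
  Rad beta = [set 0].

(** ** The twisted group algebra *)

Record cocycle_for (F : fieldType) (G : zmodType) (beta xi : G -> G -> F) :
    Prop := CocycleFor {
  cocycle_neq0 : forall a b, xi a b != 0;
  cocycleP : forall a b c, xi a b * xi (a + b) c = xi b c * xi a (b + c);
  cocycle_comm : forall a b, xi a b * (xi b a)^-1 = beta a b
}.

(* {malg F[G]} is used only as the free F-module on G: << c *g a >> is
   c u_a and x@_a is the coefficient of u_a in x. *)
Definition twisted_mul (F : fieldType) (G : zmodType) (xi : G -> G -> F)
    (x y : {malg F[G]}) : {malg F[G]} :=
  \sum_(a <- msupp x) \sum_(b <- msupp y)
     << x@_a * y@_b * xi a b *g a + b >>.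

Definition jordan_mul (F : fieldType) (G : zmodType) (xi : G -> G -> F)
    (x y : {malg F[G]}) : {malg F[G]} :=
  2%:R^-1 *: (twisted_mul xi x y + twisted_mul xi y x).

Lemma twisted_mulUU (F : fieldType) (G : zmodType) (xi : G -> G -> F)
    (a b : G) : twisted_mul xi << 1 *g a >> << 1 *g b >> = << xi a b *g a + b >>.
Proof.
by rewrite /twisted_mul !msuppU oner_eq0 !big_seq_fset1 !mcoeffUU !mul1r.
Qed.

(** ** The algebra J(R) *)

Definition in_span (F : fieldType) (G : zmodType) (R : set G) :
    {pred {malg F[G]}} := fun x => `[< forall a, a \in msupp x -> R a >].

Record J (F : fieldType) (G : zmodType) (R : set G) :=
  MkJ { Jval :> {malg F[G]}; JvalP : in_span R Jval }.

Section JModule.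
Variables (F : fieldType) (G : zmodType) (R : set G).

Lemma in_spanP (x : {malg F[G]}) :
  reflect (forall a, x@_a != 0 -> R a) (x \in in_span R).
Proof.
by apply: (iffP (asboolP _)) => h a; have := h a; rewrite mcoeff_neq0.
Qed.

Lemma in_span_submod : submod_closed (in_span (F := F) R).
Proof.
split=> [|c x y /in_spanP hx /in_spanP hy].
  by apply/in_spanP => a; rewrite mcoeff0 eqxx.
apply/in_spanP => a; rewrite mcoeffD mcoeffZ.
have [x0|/hx //] := eqVneq x@_a 0.
by rewrite x0 mulr0 add0r => /hy.
Qed.

HB.instance Definition _ :=
  GRing.isSubmodClosed.Build F {malg F[G]} (in_span R) in_span_submod.
HB.instance Definition _ := [isSub of J F R for @Jval F G R].
HB.instance Definition _ := [Choice of J F R by <:].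
HB.instance Definition _ := [SubChoice_isSubLmodule of J F R by <:].

End JModule.

Section JProduct.
Variables (F : fieldType) (G : zmodType) (R : set G) (beta xi : G -> G -> F).
Hypothesis hxi : cocycle_for beta xi.
Hypothesis hR : skew_root_system beta R.

Lemma jordan_mul_in_span (x y : J F R) : in_span R (jordan_mul xi x y).
Proof.
rewrite -[in_span R _]/(_ \in in_span R) rpredZ //.
rewrite /twisted_mul [X in _ + X]exchange_big -big_split /=.
rewrite big_seq rpred_sum // => a ax; rewrite -big_split /=.
rewrite big_seq rpred_sum // => b yb.
rewrite [b + a]addrC [y@_b * _]mulrC -monalgUD -mulrDr.
apply/in_spanP => g; rewrite mcoeffU; have [<-|_] := eqVneq (a + b) g; last first.
  by rewrite mulr0n eqxx.
rewrite mulr1n => h; apply: (srsj2 hR).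
- by move/asboolP: (JvalP x); apply.
- by move/asboolP: (JvalP y); apply.
apply: contraNneq h; rewrite -(cocycle_comm hxi) => /(canRL (mulfVK _)) ->.
  by rewrite mulN1r addNr mulr0.
exact: (cocycle_neq0 hxi).
Qed.

Definition J_mul (x y : J F R) : J F R := MkJ (jordan_mul_in_span x y).

End JProduct.

(* For a not in R this is 0, by the support condition on J(R). *)
Definition J_comp (F : fieldType) (G : zmodType) (R : set G) (a : G) :
    set (J F R) := [set x | exists c : F, Jval x = << c *g a >>].

(** ** Simplicity of nonassociative algebras *)

Section Simplicity.
Variables (F : fieldType) (A : lmodType F) (mul : A -> A -> A).

Record ideal (I : set A) : Prop := Ideal {
  ideal0 : I 0;
  idealD : forall x y, I x -> I y -> I (x + y);
  idealZ : forall (c : F) x, I x -> I (c *: x);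
  idealMl : forall x y, I y -> I (mul x y);
  idealMr : forall x y, I x -> I (mul x y)
}.

(* I is the sum of its intersections with the homogeneous components. *)
Definition graded_subset (T : Type) (comp : T -> set A) (I : set A) : Prop :=
  forall x, I x -> exists s : seq A,
    (forall y, y \in s -> I y /\ exists g, comp g y) /\ x = \sum_(y <- s) y.

Definition simple_algebra : Prop :=
  (exists x y, mul x y != 0) /\
  (forall I, ideal I -> I = [set 0] \/ I = setT).

Definition graded_simple_algebra (T : Type) (comp : T -> set A) : Prop :=
  (exists x y, mul x y != 0) /\
  (forall I, ideal I -> graded_subset comp I -> I = [set 0] \/ I = setT).

End Simplicity.

(* Main.v *)
Require Import Defs.
From HB Require Import structures.
From mathcomp Require Import all_boot all_order all_algebra.
From mathcomp Require Import finmap boolp classical_sets.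
From mathcomp Require Import monalg.

(** Write [u_a] for the basis element [<< 1 *g a >>].  The product of two basis
elements is [u_a o u_b = jcoef a b u_(a+b)], where
[jcoef a b = (xi a b + xi b a) / 2] vanishes exactly when [beta b a = -1]
([jcoef_eq0]).

The criterion behind both parts is that an ideal containing a nonzero
homogeneous element is everything ([ideal_homogeneous_full]): since
[beta a (- a) = 1], multiplying [c u_a] by [u_(- a)] gives a nonzero multiple
of [u_0], and [u_0] acts on [J(R)] as the nonzero scalar [xi 0 0].  A nonzero
graded ideal contains such an element by definition, which gives (1).

For (2), [beta] takes the values 1 and -1 only, and the square of the
multiplication by [u_b] is a nonzero multiple of the projection onto the span
of the [u_g] with [beta g b = 1] ([jordan_mul_sqr_coeff]): when [beta g b = 1]
the factors commute and [u_b (u_b u_g) = (u_b u_b) u_g] is a multiple of [u_g]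
by a scalar that does not depend on [g], because [u_b u_b] is a multiple of
[u_0]; when [beta g b = -1], already [u_b o u_g = 0].  So ideals are stable under these projections.  Because [R] generates
[G] and [Rad beta = 0], any two distinct degrees are separated by
[beta _ b] for some [b] in [R] ([reduced_separates]); hence an element
of a nonzero ideal whose support is nonempty of minimal size is homogeneous
([ideal_has_homogeneous]). *)

Import GRing.Theory.
Local Open Scope classical_set_scope.
Local Open Scope ring_scope.

(** * Bicharacters *)

Section Bicharacter.
Local Set Implicit Arguments.
Local Unset Strict Implicit.
Variables (F : fieldType) (G : zmodType) (beta : G -> G -> F).
Hypothesis hbeta : alternating_bicharacter beta.

Lemma bichar0r a : beta a 0 = 1.
Proof.
have h := bicharDr hbeta a 0 0; rewrite addr0 in h.
by apply: (mulfI (bichar_neq0 hbeta a 0)); rewrite -h mulr1.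
Qed.

Lemma bichar0l a : beta 0 a = 1.
Proof.
have h := bicharDl hbeta 0 0 a; rewrite addr0 in h.
by apply: (mulfI (bichar_neq0 hbeta 0 a)); rewrite -h mulr1.
Qed.

Lemma bicharNr a b : beta a (- b) = (beta a b)^-1.
Proof.
apply: (mulfI (bichar_neq0 hbeta a b)).
by rewrite -(bicharDr hbeta) subrr bichar0r divff ?(bichar_neq0 hbeta).
Qed.

Lemma bicharNl a b : beta (- a) b = (beta a b)^-1.
Proof.
apply: (mulfI (bichar_neq0 hbeta a b)).
by rewrite -(bicharDl hbeta) subrr bichar0l divff ?(bichar_neq0 hbeta).
Qed.

(** The elements [b] with [beta a b = beta a' b] form a subgroup; if it
contained [R] it would be [G], and [a - a'] would be in the radical. *)
Lemma reduced_separates (R : set G) : generates R -> reduced beta ->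
  forall a a', a != a' -> exists2 b, R b & beta a b != beta a' b.
Proof.
move=> genR red a a' /eqP aa'; apply: contrapT => nosep; apply: aa'.
have HT : [set b | beta a b = beta a' b] = setT.
  apply: genR => [|b Rb /=].
    split=> [|b c /= hb hc|b /= hb]; first by rewrite /= !bichar0r.
    - by rewrite !(bicharDr hbeta) hb hc.
    - by rewrite !bicharNr hb.
  by apply/eqP; apply: contrapT => /negP hb; apply: nosep; exists b.
have: Rad beta (a - a').
  move=> h; have /= e : [set b | beta a b = beta a' b] h by rewrite HT.
  by rewrite (bicharDl hbeta) bicharNl e divff ?(bichar_neq0 hbeta).
by rewrite red /= => /subr0_eq.
Qed.

Lemma bichar_sign : elementary_abelian_2group G ->
  forall a b, (beta a b == 1) || (beta a b == -1).
Proof.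
by move=> G2 a b; rewrite -sqrf_eq1 expr2 -(bicharDr hbeta) G2 bichar0r.
Qed.

End Bicharacter.

(** * Multiplication by a homogeneous element *)

Section Product.
Local Set Implicit Arguments.
Local Unset Strict Implicit.
Variables (F : fieldType) (G : zmodType).
Implicit Types (x : {malg F[G]}) (a b g : G).

(** Both one-sided twisted products with [c u_b] shift degrees by [b] and
rescale, so their coefficients are read off from this common form. *)
Lemma mcoeff_shift_sum (k : G -> F) b x g :
  (\sum_(a <- msupp x) << x@_a * k a *g b + a >> : {malg F[G]})@_g =
  x@_(g - b) * k (g - b).
Proof.
have shiftE a : (b + a == g) = (a == g - b) by rewrite addrC -subr_eq opprK.
rewrite raddf_sum /=; have [h|/mcoeff_outdom h] := boolP (g - b \in msupp x).
  rewrite (bigD1_seq _ h) ?fset_uniq //= mcoeffU shiftE eqxx mulr1n.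
  by rewrite big1 ?addr0 // => a ne; rewrite mcoeffU shiftE (negPf ne).
rewrite h mul0r big1 // => a _; rewrite mcoeffU shiftE.
by case: eqP => // ->; rewrite h mul0r.
Qed.

Variable xi : G -> G -> F.

Lemma twisted_mulUl_coeff (c : F) b x g :
  (twisted_mul xi << c *g b >> x)@_g = c * xi b (g - b) * x@_(g - b).
Proof.
rewrite /twisted_mul msuppU; have [->|c0] := eqVneq c 0.
  by rewrite big_seq_fset0 mcoeff0 !mul0r.
rewrite big_seq_fset1 mcoeffUU mulrC -(mcoeff_shift_sum (fun a => c * xi b a)).
by congr (_@_g); apply: eq_bigr => a _; rewrite (mulrC c) mulrA.
Qed.

Lemma twisted_mulUr_coeff (c : F) b x g :
  (twisted_mul xi x << c *g b >>)@_g = c * xi (g - b) b * x@_(g - b).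
Proof.
rewrite /twisted_mul msuppU; have [->|c0] := eqVneq c 0.
  by rewrite big1 ?mcoeff0 ?mul0r // => a _; rewrite big_seq_fset0.
rewrite mulrC -(mcoeff_shift_sum (fun a => c * xi a b)); congr (_@_g).
apply: eq_bigr => a _.
by rewrite big_seq_fset1 mcoeffUU -mulrA (addrC a).
Qed.

Definition jcoef a b : F := 2%:R^-1 * (xi a b + xi b a).

Lemma jordan_mulU_coeff (c : F) b x g :
  (jordan_mul xi << c *g b >> x)@_g = c * jcoef b (g - b) * x@_(g - b).
Proof.
rewrite mcoeffZ mcoeffD twisted_mulUl_coeff twisted_mulUr_coeff -mulrDl.
by rewrite -mulrDr !mulrA (mulrC c).
Qed.

End Product.

Section Cocycle.
Local Set Implicit Arguments.
Local Unset Strict Implicit.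
Variables (F : fieldType) (G : zmodType) (beta xi : G -> G -> F).
Hypotheses (F2 : 2%:R != 0 :> F).
Hypotheses (hbeta : alternating_bicharacter beta) (hxi : cocycle_for beta xi).

Lemma cocycle0l a : xi 0 a = xi 0 0.
Proof.
have := cocycleP hxi 0 0 a; rewrite !add0r.
by move/(mulIf (cocycle_neq0 hxi 0 a)).
Qed.

Lemma jcoefE a b : jcoef xi a b = 2%:R^-1 * xi a b * (1 + beta b a).
Proof.
rewrite /jcoef -(cocycle_comm hxi) -mulrA; congr (_ * _).
rewrite mulrDr mulr1; congr (_ + _).
by rewrite mulrCA divff ?mulr1 // (cocycle_neq0 hxi).
Qed.

Lemma jcoef_eq0 a b : (jcoef xi a b == 0) = (beta b a == -1).
Proof.
rewrite jcoefE !mulf_eq0 invr_eq0 (negPf F2) (negPf (cocycle_neq0 hxi _ _)) /=.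
by rewrite addrC addr_eq0.
Qed.

Lemma jcoef_commuting a b : beta b a = 1 -> jcoef xi a b = xi a b.
Proof. by move=> h; rewrite jcoefE h mulrAC mulVf // mul1r. Qed.

Lemma jcoef_opp_neq0 a : jcoef xi (- a) a != 0.
Proof.
rewrite jcoef_eq0 (bicharNr hbeta) (bichar_alt hbeta) invr1.
by rewrite -addr_eq0 -mulr2n.
Qed.

Lemma jcoef0l a : jcoef xi 0 a = xi 0 0.
Proof. by rewrite jcoef_commuting ?cocycle0l ?(bichar0r hbeta). Qed.

(** The scalar [xi b b * xi 0 0] is the one by which [u_b u_b] acts in the
twisted group algebra; its independence of [g] is what makes the square of the
multiplication by [u_b] a multiple of a projection. *)
Lemma jordan_mul_sqr_coeff : elementary_abelian_2group G ->
  forall b (x : {malg F[G]}) g,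
  (jordan_mul xi << 1 *g b >> (jordan_mul xi << 1 *g b >> x))@_g =
  if beta g b == 1 then xi b b * xi 0 0 * x@_g else 0.
Proof.
move=> G2 b x g; have Nb : - b = b by apply/eqP; rewrite eq_sym -addr_eq0 G2.
have shiftb : beta (b + g) b = beta g b.
  by rewrite (bicharDl hbeta) (bichar_alt hbeta) mul1r.
rewrite !jordan_mulU_coeff !mul1r Nb -addrA G2 addr0 (addrC g) mulrA.
case/orP: (bichar_sign hbeta G2 g b) => /eqP e; rewrite e.
  rewrite eqxx !jcoef_commuting ?shiftb //; congr (_ * _).
  by rewrite mulrC -(cocycleP hxi) G2 cocycle0l.
have -> : jcoef xi b g = 0 by apply/eqP; rewrite jcoef_eq0 e.
have /negPf -> : (-1 : F) != 1.
  by rewrite eq_sym -addr_eq0 -mulr2n.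
by rewrite mulr0 mul0r.
Qed.

(** * Ideals of [J(R)] *)

Variables (R : set G) (hR : skew_root_system beta R).
Local Notation J_prod := (J_mul hxi hR).

Lemma JP (x : J F R) a : (Jval x)@_a != 0 -> R a.
Proof. by move/in_spanP: (JvalP x); apply. Qed.

Lemma malgU_in_span c a : R a -> in_span R (<< c *g a >> : {malg F[G]}).
Proof.
move=> Ra; apply/in_spanP => b; rewrite mcoeffU.
by case: (a =P b) => [<-//|_]; rewrite mulr0n eqxx.
Qed.

Definition Ju a (Ra : R a) : J F R := MkJ (malgU_in_span 1 Ra).

(** For [a] in [R], [beta a (- a) = 1] differs from -1, so the root system is
closed under the sum [a + (- a)]. *)
Lemma root0 : R 0.
Proof.
have [a Ra] := srsj_nonempty hR; rewrite -(subrr a).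
apply: (srsj2 hR) => //; first exact: (srsj1 hR).
by rewrite -jcoef_eq0 jcoef_opp_neq0.
Qed.

Lemma JmulE (x y : J F R) :
  Jval (J_prod x y) = jordan_mul xi (Jval x) (Jval y).
Proof. by []. Qed.

Lemma JvalZ c (x : J F R) : Jval (c *: x) = c *: Jval x.
Proof. by rewrite -[LHS]/(val (c *: x)) linearZ. Qed.

Lemma J_mul_nonzero : exists x y : J F R, J_prod x y != 0.
Proof.
exists (Ju root0), (Ju root0); apply/eqP => /(congr1 (@Jval F G R)) h.
have := congr1 (fun z : {malg F[G]} => z@_0) h.
rewrite JmulE jordan_mulU_coeff subr0 jcoef0l mcoeff0 /= mcoeffUU mul1r mulr1.
by apply/eqP; rewrite (cocycle_neq0 hxi).
Qed.

(** The element [u_(-a) o u_a] is a nonzero multiple of [u_0], which acts on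
[J(R)] by a nonzero scalar. *)
Lemma ideal_homogeneous_full (I : set (J F R)) (z : J F R) a c :
  ideal J_prod I -> I z -> c != 0 -> Jval z = << c *g a >> -> I = setT.
Proof.
move=> hI Iz c0 ez.
have Ra : R a by apply: (@JP z); rewrite ez mcoeffUU.
pose w := J_prod (Ju (srsj1 hR Ra)) z.
have Iw : I w by exact: (idealMl hI).
have ew : Jval w = << jcoef xi (- a) a * c *g 0 >>.
  apply/malgP => g; rewrite JmulE jordan_mulU_coeff mul1r opprK ez !mcoeffU.
  rewrite -subr_eq0 opprD addrCA subrr addr0 oppr_eq0 (eq_sym 0).
  by case: eqP => [->|_]; rewrite ?add0r // mulr0.
set d := _ * c in ew.
have k0 : d * xi 0 0 != 0.
  apply: mulf_neq0; last exact: (cocycle_neq0 hxi).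
  by apply: mulf_neq0; first exact: jcoef_opp_neq0.
rewrite -subTset => y _.
have -> : y = (d * xi 0 0)^-1 *: J_prod w y.
  apply: val_inj; apply/malgP => g.
  rewrite [val (_ *: _)]JvalZ mcoeffZ JmulE.
  by rewrite ew jordan_mulU_coeff subr0 jcoef0l mulKf.
by apply: (idealZ hI); exact: (Defs.idealMr hI).
Qed.

(** Induction on the size of the support: if two degrees occur in [x], an
element of [R] separating them yields a projection of [x], again in [I] up to
a nonzero scalar, that keeps one of the two degrees and kills the other. *)
Lemma ideal_has_homogeneous (I : set (J F R)) (x : J F R) :
  elementary_abelian_2group G -> reduced beta -> ideal J_prod I ->
  I x -> x != 0 ->
  exists z a c, [/\ I z, c != 0 & Jval z = << c *g a >>].
Proof.
move=> G2 red hI.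
have [n] := ubnP #|` msupp (Jval x)|; elim: n x => // n IHn x ltn Ix x0.
have [a ax] : exists a, (Jval x)@_a != 0.
  apply: contrapT => h; case/eqP: x0; apply: val_inj; apply/malgP => a.
  rewrite mcoeff0; apply/eqP; apply: contrapT => /negP ha.
  by apply: h; exists a.
have [|ne] := pselect (Jval x = << (Jval x)@_a *g a >>).
  by move=> e; exists x, a, (Jval x)@_a.
have [a' a'x aa'] : exists2 a', (Jval x)@_a' != 0 & a != a'.
  apply: contrapT => h; apply: ne; apply/malgP => a'; rewrite mcoeffU.
  case: eqP => [<-//|/eqP aa']; apply/eqP; apply: contrapT => /negP ha'.
  by apply: h; exists a'.
have [b Rb sep] := reduced_separates hbeta (srsj0 hR) red aa'.
pose y := J_prod (Ju Rb) (J_prod (Ju Rb) x).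
have yE g : (Jval y)@_g =
    if beta g b == 1 then xi b b * xi 0 0 * (Jval x)@_g else 0.
  by rewrite /y !JmulE jordan_mul_sqr_coeff.
have Iy : I y by do 2! apply: (idealMl hI).
have suppS : (msupp (Jval y) `<=` msupp (Jval x))%fset.
  apply/fsubsetP => g; rewrite -!mcoeff_neq0 yE.
  by case: ifP; rewrite ?eqxx // mulf_eq0 negb_or => _ /andP[].
(* Stated for arbitrary [e], [e'] because either of [a], [a'] may survive. *)
have smaller e e' : beta e b = 1 -> beta e' b != 1 ->
    (Jval x)@_e != 0 -> (Jval x)@_e' != 0 ->
    exists z a c, [/\ I z, c != 0 & Jval z = << c *g a >>].
  move=> be be' ex e'x; apply: (IHn y) => //.
    rewrite -ltnS; apply: leq_trans ltn; rewrite ltnS; apply: fproper_ltn_card.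
    rewrite fproperEneq suppS andbT; apply/eqP => /fsetP /(_ e').
    by rewrite -!mcoeff_neq0 yE (negPf be') eqxx e'x.
  apply/eqP => y0; have := yE e.
  rewrite y0 be eqxx mcoeff0 => /esym/eqP; apply/negP.
  by rewrite !mulf_neq0 // (cocycle_neq0 hxi).
have [ba|ba] := eqVneq (beta a b) 1.
  by apply: (smaller a a') => //; rewrite eq_sym -ba.
have [ba'|ba'] := eqVneq (beta a' b) 1; first exact: (smaller a' a).
have := bichar_sign hbeta G2 a b; rewrite (negPf ba) /= => /eqP h.
have := bichar_sign hbeta G2 a' b; rewrite (negPf ba') /= => /eqP h'.
by rewrite h h' eqxx in sep.
Qed.

Lemma ideal_zeroVnonzero (I : set (J F R)) : ideal J_prod I ->
  I = [set 0] \/ exists2 x, I x & x != 0.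
Proof.
move=> hI; have [|noI] := pselect (exists2 x, I x & x != 0); first by right.
left; apply/seteqP; split=> [x Ix|_ ->]; last exact: (ideal0 hI).
by apply/eqP; apply: contrapT => /negP x0; apply: noI; exists x.
Qed.

Lemma J_graded_simple : graded_simple_algebra J_prod (@J_comp F G R).
Proof.
split=> [|I hI grI]; first exact: J_mul_nonzero.
have [|[x Ix x0]] := ideal_zeroVnonzero hI; [by left|right].
have [s [hs ex]] := grI x Ix.
have [/allP s0|/allPn[y ys y0]] := boolP (all (pred1 0) s).
  by case/eqP: x0; rewrite ex big_seq big1 // => y /s0/eqP.
have [Iy [a [c ey]]] := hs y ys.
apply: (ideal_homogeneous_full hI Iy _ ey).
by apply: contraNneq y0 => c0; apply/eqP/val_inj; rewrite /= ey c0 monalgU0.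
Qed.

Lemma J_simple : reduced beta -> elementary_abelian_2group G ->
  simple_algebra J_prod.
Proof.
move=> red G2; split=> [|I hI]; first exact: J_mul_nonzero.
have [|[x Ix x0]] := ideal_zeroVnonzero hI; [by left|right].
have [z [a [c [Iz c0 ez]]]] := ideal_has_homogeneous G2 red hI Ix x0.
exact: (ideal_homogeneous_full hI Iz c0 ez).
Qed.

End Cocycle.

Theorem proposition4p13 (F : closedFieldType) (charF0 : [pchar F] =i pred0)
    (G : zmodType) (Gfg : finitely_generated G)
    (beta : G -> G -> F) (hbeta : alternating_bicharacter beta) :
  (forall (R : set G) (hR : skew_root_system beta R)
          (xi : G -> G -> F) (hxi : cocycle_for beta xi),
     graded_simple_algebra (J_mul hxi hR) (@J_comp F G R))
  /\
  (forall (R : set G) (hR : skew_root_system beta R)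
          (xi : G -> G -> F) (hxi : cocycle_for beta xi),
     reduced beta -> elementary_abelian_2group G ->
     simple_algebra (J_mul hxi hR)).
Proof.
have F2 : 2%:R != 0 :> F by rewrite ((pcharf0P F).1 charF0).
split=> R hR xi hxi; first exact: J_graded_simple.
by move=> red G2; exact: J_simple.
Qed.
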